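(* If $f,g\in L^2(\Omega)$ then $\widehat f,\widehat g\in l^2_{\mathrm L}$, $\widehat f_*,\widehat g_*\in l^2_{\mathrm L^*}$, and the inner products of $l^2_{\mathrm L}$ and $l^2_{\mathrm L^*}$ take the form $$(\widehat f,\widehat g)_{l^2_{\mathrm L}}=\sum_{\xi\in\mathcal I}\widehat f(\xi)\overline{\widehat g_*(\xi)},\qquad (\widehat f_*,\widehat g_* )_{l^2_{\mathrm L^*}}=\sum_{\xi\in\mathcal I}\widehat f_*(\xi)\overline{\widehat g(\xi)}.$$ In particular, $\overline{(\widehat f,\widehat g)_{l^2_{\mathrm L}}}=(\widehat g_*,\widehat f_* )_{l^2_{\mathrm L^*}}$. The Parseval identity takes the form $$(f,g)_{L^2}=(\widehat f,\widehat g)_{l^2_{\mathrm L}}=\sum_{\xi\in\mathcal I}\widehat f(\xi)\overline{\widehat g_*(\xi)}.$$ Furthermore, for any $f\in L^2(\Omega)$ we have $\widehat f\in l^2_{\mathrm L}$, $\widehat f_*\in l^2_{\mathrm L^*}$, and $$\|f\|_{L^2}=\|\widehat f\|_{l^2_{\mathrm L}}=\|\widehat f_*\|_{l^2_{\mathrm L^*}}.$$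
   Context: Setting. $\Omega\subset\mathbb R^n$ ($n\ge 1$) is a bounded open set. $\mathrm L$ is a differential operator of order $m$ with smooth coefficients in $\Omega$, equipped with linear boundary conditions (the functions satisfying them form a linear space), viewed as an operator in $L^2(\Omega)$ with domain $\mathrm{Dom}(\mathrm L)$; $\mathrm L^*$ is its adjoint, with the adjoint boundary conditions and domain $\mathrm{Dom}(\mathrm L^* )$. $\mathcal I$ is a countable subset of some $\mathbb Z^K$; $\mathrm L$ has discrete spectrum $\{\lambda_\xi\}_{\xi\in\mathcal I}\subset\mathbb C$, listed with multiplicities so that $|\lambda_j|\le|\lambda_k|$ whenever $|j|\le|k|$. There are eigenfunctions $u_\xi\in\mathrm{Dom}(\mathrm L)$, $\mathrm Lu_\xi=\lambda_\xi u_\xi$, and $v_\xi\in\mathrm{Dom}(\mathrm L^* )$, $\mathrm L^*v_\xi=\overline{\lambda_\xi}v_\xi$, with $\|u_\xi\|_{L^2}=1$ and $(u_\xi,v_\eta)_{L^2}=\delta_{\xi\eta}$, where $(f,g)_{L^2}=\int_\Omega f\overline g\,dx$; both $\{u_\xi\}$ and $\{v_\xi\}$ are Riesz bases of $L^2(\Omega)$. Boundary conditions are preserved under limits (the spaces $\bigcap_k\mathrm{Dom}(\mathrm L^k)$ and $\bigcap_k\mathrm{Dom}((\mathrm L^* )^k)$ with norms $\max_{j\le k}\|\mathrm L^j\varphi\|_{L^2}$, resp. $\max_{j\le k}\|(\mathrm L^* )^j\varphi\|_{L^2}$, are complete). Fourier transforms: $\mathcal F_{\mathrm L}f(\xi)=\widehat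 f(\xi)=\int_\Omega f\,\overline{v_\xi}\,dx$ and $\mathcal F_{\mathrm L^*}f(\xi)=\widehat f_*(\xi)=\int_\Omega f\,\overline{u_\xi}\,dx$, with inverses $\mathcal F_{\mathrm L}^{-1}h=\sum_\xi h(\xi)u_\xi$, $\mathcal F_{\mathrm L^*}^{-1}h=\sum_\xi h(\xi)v_\xi$. $l^2_{\mathrm L}$ is the space of $a:\mathcal I\to\mathbb C$ with $\mathcal F_{\mathrm L}^{-1}a\in L^2(\Omega)$ (i.e. $a=\mathcal F_{\mathrm L}f$ for some $f\in L^2(\Omega)$), with inner product $(a,b)_{l^2_{\mathrm L}}=\sum_\xi a(\xi)\overline{(\mathcal F_{\mathrm L^*}\circ\mathcal F_{\mathrm L}^{-1}b)(\xi)}$ and norm $\|a\|_{l^2_{\mathrm L}}=(a,a)_{l^2_{\mathrm L}}^{1/2}$. $l^2_{\mathrm L^*}$ is the space of $a:\mathcal I\to\mathbb C$ with $\mathcal F_{\mathrm L^*}^{-1}a\in L^2(\Omega)$, with inner product $(a,b)_{l^2_{\mathrm L^*}}=\sum_\xi a(\xi)\overline{(\mathcal F_{\mathrm L}\circ\mathcal F_{\mathrm L^*}^{-1}b)(\xi)}$ and the corresponding norm. *)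

(* Defs.v *)
From HB Require Import structures.
From mathcomp Require Import all_boot all_order all_algebra finmap.
From mathcomp Require Import all_classical all_reals all_analysis.
From mathcomp Require Import complex lra.
From mathcomp Require Import summability.
Import Order.TTheory GRing.Theory Num.Theory.
Import numFieldNormedType.Exports.
Set Implicit Arguments.
Unset Strict Implicit.
Unset Printing Implicit Defensive.
Local Open Scope classical_set_scope.
Local Open Scope complex_scope.
Local Open Scope ring_scope.

Definition measure_rV_display : measure_display -> measure_display.
Proof. exact. Qed.

(* 'rV[R]_n carries the product of the Borel sigma-algebras of its coordinates
   (as the library does for n.-tuple); open_measurable_rV shows that it contains
   the open sets. *)
Section measurable_rV.
Context {R : realType} {n : nat}.

Definition rV_coord (i : 'I_n) (x : 'rV[R]_n) : measurableTypeR R := x ord0 i.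

Let rV_set0 : g_sigma_preimage rV_coord set0.
Proof. exact: sigma_algebra0. Qed.

Let rV_setC A : g_sigma_preimage rV_coord A -> g_sigma_preimage rV_coord (~` A).
Proof. exact: sigma_algebraC. Qed.

Let rV_bigcup (F : _^nat) : (forall i, g_sigma_preimage rV_coord (F i)) ->
  g_sigma_preimage rV_coord (\bigcup_i (F i)).
Proof. exact: sigma_algebra_bigcup. Qed.

HB.instance Definition _ := @isMeasurable.Build
  (measure_rV_display (R.-ocitv.-measurable).-sigma)
  'rV[R]_n (g_sigma_preimage rV_coord) rV_set0 rV_setC rV_bigcup.

Lemma measurable_rV_coord (i : 'I_n) :
  measurable_fun [set: 'rV[R]_n] (fun x => x ord0 i).
Proof.
move=> _ Y mY; rewrite setTI; apply: sub_sigma_algebra => /=.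
rewrite -bigcup_seq/=; exists i => /=; first by rewrite mem_index_enum.
by exists Y => //; rewrite setTI.
Qed.


End measurable_rV.

Lemma measurable_fun_rV (R : realType) n d (T : measurableType d)
    (f : T -> 'rV[R]_n) :
  (forall i, measurable_fun [set: T] (fun x => f x ord0 i)) ->
  measurable_fun [set: T] f.
Proof.
move=> mf.
have h : g_sigma_preimage (fun i => rV_coord i \o f) `<=` measurable.
  apply: smallest_sub; first exact: sigma_algebra_measurable.
  case: n => [|n] in f mf *; first by rewrite big_ord0.
  rewrite -bigcup_mkord_ord; apply: bigcup_sub => i Ii.
  by move=> A [B mB <-]; exact: mf.
move=> _ A mA; apply: h.
by rewrite g_sigma_preimage_comp; exists A.
Qed.

Section lebesgue_rV.
Context {R : realType}.

Definition rV_cons n (p : 'rV[R]_n * measurableTypeR R) : 'rV[R]_n.+1 :=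
  \row_i (if unlift ord0 i is Some j then p.1 ord0 j else p.2).

Lemma measurable_rV_cons n : measurable_fun [set: _] (@rV_cons n).
Proof.
apply: measurable_fun_rV => i; case: (unliftP ord0 i) => [j ->|->].
  rewrite (_ : (fun _ => _) = (fun x : 'rV[R]_n => x ord0 j) \o fst).
    by apply: measurableT_comp => //; exact: measurable_rV_coord.
  by apply: funext => p; rewrite mxE liftK.
by rewrite (_ : (fun _ => _) = snd)//; apply: funext => p;
  rewrite mxE unlift_none.
Qed.

Definition lebesgue_rV_step n (mu : {measure set 'rV[R]_n -> \bar R}) :=
  pushforward (mu \x lebesgue_measure)%E (@rV_cons n).

HB.instance Definition _ n (mu : {measure set 'rV[R]_n -> \bar R}) :=
  Measure.copy (lebesgue_rV_step mu)
    (measure_function_pushforward__canonical__measure_function_Measure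
      (mu \x lebesgue_measure)%E (@measurable_rV_cons n)).

(* Lebesgue measure on R^n as the n-fold product of Lebesgue measure on R;
   lebesgue_rV_box gives its value on boxes. *)
Fixpoint lebesgue_rV n : {measure set 'rV[R]_n -> \bar R} :=
  if n is n'.+1 then lebesgue_rV_step (lebesgue_rV n')
  else dirac (0 : 'rV[R]_0).

Lemma measurable_box n (A : 'I_n -> set (measurableTypeR R)) :
  (forall i, measurable (A i)) ->
  measurable [set x : 'rV[R]_n | forall i, A i (x ord0 i)].
Proof.
move=> mA.
rewrite (_ : [set x | _] = \bigcap_(i in [set: 'I_n])
   ((fun x : 'rV[R]_n => x ord0 i) @^-1` A i)).
  apply: fin_bigcap_measurable; first by [].
  by move=> i _; have := measurable_rV_coord i measurableT (mA i); rewrite setTI.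
by apply/seteqP; split => [x Ax i _|x Ax i]; [exact: Ax|exact: Ax].
Qed.

Lemma open_measurable_rV n (A : set 'rV[R]_n) : open A -> measurable A.
Proof.
move=> oA.
pose box (pq : 'rV[rat]_n * 'rV[rat]_n) : set 'rV[R]_n :=
  [set x | forall i,
    `]ratr (pq.1 ord0 i), ratr (pq.2 ord0 i)[%classic (x ord0 i)].
pose F pq := if pselect (box pq `<=` A) then box pq else set0.
rewrite (_ : A = \bigcup_pq F pq); last first.
  apply/seteqP; split => [x Ax|x [pq _]]; last first.
    by rewrite /F; case: pselect => // sub /sub.
  have /nbhs_ballP[e e0 xeA] : nbhs x A by apply: open_nbhs_nbhs.
  have xp i := @rat_in_itvoo R (x ord0 i - e) (x ord0 i)
    ltac:(by rewrite ltrBlDr ltrDl).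
  have xq i := @rat_in_itvoo R (x ord0 i) (x ord0 i + e) ltac:(by rewrite ltrDl).
  have [p px] := choice xp; have [q qx] := choice xq.
  exists (\row_i p i, \row_i q i) => //; rewrite /F; case: pselect => [_ i|]/=.
    move: (px i) (qx i); rewrite !in_itv/= !mxE => /andP[_ ->] /andP[-> _] //.
  case=> y /= xy; apply: xeA; split=> // i j.
  rewrite (_ : i = ord0); last exact: ord1.
  have : y ord0 j \in `]ratr (p j), ratr (q j)[ by have := xy j; rewrite /= !mxE.
  move: (px j) (qx j); rewrite !in_itv/= /ball/=.
  move=> /andP[p1 p2] /andP[q1 q2] /andP[y1 y2].
  by rewrite ltr_distlC; apply/andP; split; lra.
apply: countable_bigcupT_measurable => [|pq]; first exact: countableP.
rewrite /F; case: (pselect _) => [boxA|nboxA]; last exact: measurable0.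
apply: (@measurable_box n (fun i =>
  `]ratr (pq.1 ord0 i), ratr (pq.2 ord0 i)[%classic)) => i.
exact: measurable_itv.
Qed.

Lemma lebesgue_rV_box n (A : 'I_n -> set (measurableTypeR R)) :
  (forall i, measurable (A i)) ->
  lebesgue_rV n [set x | forall i, A i (x ord0 i)] =
  (\prod_(i < n) lebesgue_measure (A i))%E.
Proof.
elim: n A => [|n ih] A mA.
  rewrite big_ord0 /= diracE mem_set// => -[]//.
rewrite big_ord_recl muleC -ih// -product_measure1E//; last first.
  by apply: (@measurable_box n (fun i => A (lift ord0 i))) => i; exact: mA.
rewrite /= /lebesgue_rV_step /pushforward; congr (_ _).
apply/seteqP; split => [[x y]/= h|[x y]/= [hx hy] i].
  split => [i|].
    by have := h (lift ord0 i); rewrite mxE liftK.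
  by have := h ord0; rewrite mxE unlift_none.
by rewrite mxE; case: (unliftP ord0 i) => [j ->|->]; [exact: hx|exact: hy].
Qed.
End lebesgue_rV.

Local Notation Re := complex.Re.
Local Notation Im := complex.Im.

Section L2_space.
Context {R : realType} {n : nat}.
Variable Omega : set 'rV[R]_n.
Local Notation mu := (lebesgue_rV n).
Local Notation fn := ('rV[R]_n -> R[i]).
Implicit Types f g h : fn.

Definition cintegral f : R[i] :=
  (\int[mu]_(x in Omega) Re (f x)) +i* (\int[mu]_(x in Omega) Im (f x)).

(* Elements of L^2(Omega) are handled through representatives; only the values
   on Omega matter, and equality in L^2(Omega) is ae_eq mu Omega. *)
Definition in_L2 f : Prop :=
  [/\ measurable_fun Omega (fun x => Re (f x)),
      measurable_fun Omega (fun x => Im (f x)) &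
      (\int[mu]_(x in Omega) (Normc.normc (f x) ^+ 2)%:E < +oo)%E].

Definition L2_eq f g : Prop := ae_eq mu Omega f g.

Definition L2_inner f g : R[i] := cintegral (fun x => f x * (g x)^*).

Definition L2_norm f : R :=
  Num.sqrt (\int[mu]_(x in Omega) (Normc.normc (f x) ^+ 2)).

(* V has dimension d modulo almost-everywhere equality *)
Definition L2_dim (V : set fn) (d : nat) : Prop :=
  exists e : 'I_d -> fn,
    [/\ forall i, V (e i),
        forall c : 'I_d -> R[i],
          L2_eq (fun x => \sum_(i < d) c i * e i x) (fun=> 0) ->
          forall i, c i = 0 &
        forall f, V f ->
          exists c : 'I_d -> R[i], L2_eq f (fun x => \sum_(i < d) c i * e i x)].

End L2_space.

Section differential_operator.
Context {R : realType} {n : nat}.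
Variable Omega : set 'rV[R]_n.
Local Notation fn := ('rV[R]_n -> R[i]).
Implicit Types f g phi : fn.

Definition cpartial (i : 'I_n) f : fn := fun x =>
  ('D_(delta_mx ord0 i) (fun y => Re (f y)) x) +i*
  ('D_(delta_mx ord0 i) (fun y => Im (f y)) x).

Definition smooth_on f : Prop :=
  forall (s : seq 'I_n) (x : 'rV[R]_n), Omega x ->
    let h := foldr cpartial f s in
    [/\ {for x, continuous (fun y => Re (h y) : R)},
        {for x, continuous (fun y => Im (h y) : R)} &
        forall i : 'I_n,
          derivable (fun y => Re (h y)) x (delta_mx ord0 i) /\
          derivable (fun y => Im (h y)) x (delta_mx ord0 i)].

Definition test_function phi : Prop :=
  smooth_on phi /\
  exists K : set 'rV[R]_n,
    [/\ compact K, K `<=` Omega & forall x, ~ K x -> phi x = 0].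

Section fixed_order.
Variable m : nat.

(* This finite type contains every multi-index of length at most m. *)
Local Notation mindex := {ffun 'I_n -> 'I_m.+1}.

Definition mlength (alpha : mindex) : nat := (\sum_(i < n) alpha i)%N.

Definition mpartial (alpha : mindex) f : fn :=
  foldr (fun i h => iter (alpha i) (cpartial i) h) f (enum 'I_n).

(* sum_{|alpha| <= m} a_alpha D^alpha has smooth coefficients and order m *)
Definition smooth_diffop (a : mindex -> fn) : Prop :=
  (forall alpha, (mlength alpha <= m)%N -> smooth_on (a alpha)) /\
  exists alpha x, [/\ mlength alpha = m, Omega x & a alpha x != 0].

(* sum_{|alpha| <= m} a_alpha D^alpha f = g in the sense of distributions *)
Definition diffop_eq (a : mindex -> fn) f g : Prop :=
  forall phi, test_function phi ->
    cintegral Omega (fun x => g x * phi x) =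
    \sum_(alpha | (mlength alpha <= m)%N)
      (-1) ^+ mlength alpha *
      cintegral Omega
        (fun x => f x * mpartial alpha (fun y => a alpha y * phi y) x).

End fixed_order.

(* Boundary conditions are represented by the set of functions satisfying them;
   as conditions on elements of L^2 they must respect a.e. equality. *)
Definition linear_bc (BC : set fn) : Prop :=
  [/\ BC (fun=> 0),
      forall (c : R[i]) f g, BC f -> BC g -> BC (fun x => c * f x + g x) &
      forall f g, L2_eq Omega f g -> BC f -> BC g].

End differential_operator.

(* Unbounded operators of L^2(Omega) are given by their graphs: A f g means
   f \in Dom(A) and A f = g. *)
Section operators.
Context {R : realType} {n : nat}.
Variable Omega : set 'rV[R]_n.
Local Notation fn := ('rV[R]_n -> R[i]).
Local Notation operator := (fn -> fn -> Prop).
Implicit Types (A : operator) (f g h : fn).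

Definition realization m (a : {ffun 'I_n -> 'I_m.+1} -> fn) (BC : set fn)
    : operator :=
  fun f g => [/\ in_L2 Omega f, in_L2 Omega g, BC f & diffop_eq Omega a f g].

(* The adjoint boundary conditions are the ones implied by membership in the
   domain of the Hilbert space adjoint. *)
Definition adjoint A : operator :=
  fun v w => [/\ in_L2 Omega v, in_L2 Omega w &
    forall f g, A f g -> L2_inner Omega g v = L2_inner Omega f w].

Fixpoint op_pow A (k : nat) : operator :=
  if k is k'.+1 then fun f g => exists2 h, op_pow A k' f h & A h g
  else fun f g => [/\ in_L2 Omega f, in_L2 Omega g & L2_eq Omega f g].

Definition op_dom A : set fn := [set f | exists g, A f g].

Definition op_apply A f : fn := xget (fun=> 0) [set g | A f g].

Definition dom_infty A : set fn := [set f | forall k, op_dom (op_pow A k) f].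

Definition dom_norm A (k : nat) f : R :=
  \big[Num.max/0]_(j < k.+1) L2_norm Omega (op_apply (op_pow A j) f).

Definition dom_infty_complete A : Prop :=
  forall phi : nat -> fn,
    (forall i, dom_infty A (phi i)) ->
    (forall (k : nat) (e : R), 0 < e -> exists N : nat, forall i j : nat,
       (N <= i)%N -> (N <= j)%N -> dom_norm A k (phi i \- phi j) < e) ->
    exists2 f, dom_infty A f &
      forall k : nat, dom_norm A k (phi i \- f) @[i --> \oo] --> (0 : R).

(* A - z, the result being taken up to a.e. equality *)
Definition op_shift A (z : R[i]) : operator :=
  fun f g => in_L2 Omega g /\
    exists2 h, A f h & L2_eq Omega g (fun x => h x - z * f x).

(* A - z is a bijection from Dom(A) onto L^2 with bounded inverse *)
Definition resolvent_set A : set R[i] := [set z |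
  (forall f, op_shift A z f (fun=> 0) -> L2_eq Omega f (fun=> 0)) /\
  exists M : R, forall h, in_L2 Omega h ->
    exists2 f, op_shift A z f h & L2_norm Omega f <= M * L2_norm Omega h].

Definition spectrum A : set R[i] := ~` resolvent_set A.

Definition root_space A (z : R[i]) : set fn :=
  [set f | exists k, op_pow (op_shift A z) k f (fun=> 0)].

(* The spectrum of A is {lam xi}, consists of isolated points of finite
   (algebraic) multiplicity, and each point is listed according to its
   multiplicity. *)
Definition discrete_spectrum A (I : Type) (lam : I -> R[i]) : Prop :=
  [/\ spectrum A = range lam,
      forall z, spectrum A z -> exists2 e : R, 0 < e &
        forall z', spectrum A z' -> Normc.normc (z' - z) < e -> z' = z &
      forall z, exists d : nat,
        ([set xi | lam xi = z] #= `I_d)%card /\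
        L2_dim Omega (root_space A z) d].

Definition bounded_linear (U : fn -> fn) : Prop :=
  [/\ forall f, in_L2 Omega f -> in_L2 Omega (U f),
      forall (c : R[i]) f g, in_L2 Omega f -> in_L2 Omega g ->
        L2_eq Omega (U (fun x => c * f x + g x)) (fun x => c * U f x + U g x) &
      exists M : R, forall f, in_L2 Omega f ->
        L2_norm Omega (U f) <= M * L2_norm Omega f].

End operators.

(* Sums over the index set are unordered: limits of the finite partial sums
   along the finite subsets of I directed by inclusion. *)
Section bases.
Context {R : realType} {n : nat}.
Variable Omega : set 'rV[R]_n.
Context {I : choiceType}.
Local Notation fn := ('rV[R]_n -> R[i]).
Implicit Types (w e : I -> fn) (a b c : I -> R[i]) (f h : fn).

Definition csummable c : Prop :=
  cvg (partial_sum (fun xi => Re (c xi)) @ totally) /\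
  cvg (partial_sum (fun xi => Im (c xi)) @ totally).

Definition csum c : R[i] :=
  summability.sum (fun xi => Re (c xi) : R) +i*
  summability.sum (fun xi => Im (c xi) : R).

Definition fin_comb a w (S : {fset I}) : fn :=
  fun x => partial_sum (fun xi => a xi * w xi x) S.

Definition orthonormal_basis e : Prop :=
  [/\ forall xi, in_L2 Omega (e xi),
      forall xi eta, L2_inner Omega (e xi) (e eta) = (xi == eta)%:R &
      forall f, in_L2 Omega f -> forall eps : R, 0 < eps ->
        exists (S : {fset I}) c, L2_norm Omega (f \- fin_comb c e S) < eps].

(* image of an orthonormal basis under a bounded invertible operator *)
Definition riesz_basis w : Prop :=
  exists (e : I -> fn) (U V : fn -> fn),
    [/\ orthonormal_basis e,
        bounded_linear Omega U /\ bounded_linear Omega V,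
        forall f, in_L2 Omega f -> L2_eq Omega (U (V f)) f,
        forall f, in_L2 Omega f -> L2_eq Omega (V (U f)) f &
        forall xi, in_L2 Omega (w xi) /\ L2_eq Omega (w xi) (U (e xi))].

(* fourier v is F_L and fourier u is F_{L^*}. *)
Definition fourier w f : I -> R[i] := fun xi => L2_inner Omega f (w xi).

(* h = \sum_xi a(xi) w_xi in L^2(Omega) *)
Definition expands w a h : Prop :=
  in_L2 Omega h /\
  L2_norm Omega (h \- fin_comb a w S) @[S --> totally] --> (0 : R).

(* inv_fourier u is F_L^{-1} and inv_fourier v is F_{L^*}^{-1}; the value is
   determined up to a.e. equality. *)
Definition inv_fourier w a : fn := xget (fun=> 0) [set h | expands w a h].

(* a \in l^2_L for w = u, and a \in l^2_{L^*} for w = v *)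
Definition in_l2 w a : Prop := exists h, expands w a h.

(* The inner product of l^2_L for w = u, where fourier u \o inv_fourier u is
   F_{L^*} \o F_L^{-1}; that of l^2_{L^*} for w = v, where
   fourier v \o inv_fourier v is F_L \o F_{L^*}^{-1}. *)
Definition l2_inner w a b : R[i] :=
  csum (fun xi => a xi * (fourier w (inv_fourier w b) xi)^*).

Definition l2_norm w a : R[i] := sqrtC (l2_inner w a a).

End bases.

(* squared Euclidean norm of an index *)
Definition index_norm2 (K : nat) (k : 'rV[int]_K) : int :=
  \sum_(i < K) k ord0 i ^+ 2.

Record nonharmonic_setting (R : realType) (n : nat) (Omega : set 'rV[R]_n)
    (m : nat) (a : {ffun 'I_n -> 'I_m.+1} -> 'rV[R]_n -> R[i])
    (BC : set ('rV[R]_n -> R[i])) (K : nat) (I : set 'rV[int]_K)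
    (lam : I -> R[i]) (u v : I -> 'rV[R]_n -> R[i]) : Prop := {
  ns_open : open Omega;
  ns_bounded : bounded_set Omega;
  ns_diffop : smooth_diffop Omega a;
  ns_bc : linear_bc Omega BC;
  ns_spectrum : discrete_spectrum Omega (realization Omega a BC) lam;
  ns_order : forall j k : I,
    index_norm2 (set_val j) <= index_norm2 (set_val k) ->
    Normc.normc (lam j) <= Normc.normc (lam k);
  ns_eigen : forall xi,
    realization Omega a BC (u xi) (fun x => lam xi * u xi x);
  ns_eigen_adj : forall xi,
    adjoint Omega (realization Omega a BC) (v xi)
      (fun x => (lam xi)^* * v xi x);
  ns_normalized : forall xi, L2_norm Omega (u xi) = 1;
  ns_biorthogonal : forall xi eta,
    L2_inner Omega (u xi) (v eta) = (xi == eta)%:R;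
  ns_riesz : riesz_basis Omega u;
  ns_riesz_adj : riesz_basis Omega v;
  ns_complete : dom_infty_complete Omega (realization Omega a BC);
  ns_complete_adj :
    dom_infty_complete Omega (adjoint Omega (realization Omega a BC))
}.

(* Main.v *)
Require Import Defs.
From HB Require Import structures.
From mathcomp Require Import all_boot all_order all_algebra finmap.
From mathcomp Require Import all_classical all_reals all_analysis.
From mathcomp Require Import complex summability measurable_realfun lra ring.
Import Order.TTheory GRing.Theory Num.Theory.
Import numFieldNormedType.Exports.
Local Open Scope classical_set_scope.
Local Open Scope complex_scope.
Local Open Scope ring_scope.

(** In a (semi-)inner product space the statement follows from one fact: for
  [f] in L^2 the series [sum_xi (f, v_xi) u_xi] converges unconditionally to
  [f] in norm ([riesz_expands]), and likewise with [u] and [v] exchanged.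
  Pairing the expansion of [f] with [g], which Cauchy-Schwarz allows termwise
  ([inner_cvg], [expands_inner]), gives
  [(f, g) = sum_xi (f, v_xi) (u_xi, g) = sum_xi (f, v_xi) (g, u_xi)^*],
  the Parseval identity ([riesz_Parseval]).  The two inner products on
  sequences are then both equal to the one of L^2, whence their conjugation
  symmetry and the equality of the norms.

  The expansion is obtained by transport.  A Riesz basis [u] is the image
  [u_xi = U e_xi] of an orthonormal basis [e] under an invertible bounded [U]
  with inverse [V].  The vector [V f] is the sum of its expansion along [e]:
  a projection on a finite part of [e] is the best approximation by
  combinations of that part, and finite combinations are dense
  ([orthonormal_expands]).  Applying [U] gives an expansion of [f] along [u]
  with some coefficients [c], and pairing it with [v_eta] yields
  [c_eta = (f, v_eta)] by biorthogonality.

  The spaces of sequences are defined through an inverse Fourier transform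
  that chooses some representative of the sum.  The choice is harmless, since
  the pairings of the sum with the basis are determined by the coefficients
  ([l2_inner_expands]).

  Functions are never quotiented by almost-everywhere equality: the L^2 pairing
  is handled as a semi-inner product, for which Cauchy-Schwarz still holds, and
  the identities satisfied by [U] and [V], which hold only almost everywhere,
  enter through norms, which do not see null sets ([L2_norm_eq_ae]). *)

Set Implicit Arguments.
Unset Strict Implicit.
Unset Printing Implicit Defensive.

Local Notation Re := complex.Re.
Local Notation Im := complex.Im.

#[local] Existing Instance totally_filter.

(** * Real and imaginary parts *)

Section complex_parts.
Context {R : rcfType}.
Implicit Types z w : R[i].

Lemma conjCE z : z^* = conjc z. Proof. by []. Qed.

Lemma ReD z w : Re (z + w) = Re z + Re w. Proof. by case: z w => [? ?] []. Qed.
Lemma ReB z w : Re (z - w) = Re z - Re w. Proof. by case: z w => [? ?] []. Qed.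
Lemma ImD z w : Im (z + w) = Im z + Im w. Proof. by case: z w => [? ?] []. Qed.
Lemma ImB z w : Im (z - w) = Im z - Im w. Proof. by case: z w => [? ?] []. Qed.
Lemma ReM z w : Re (z * w) = Re z * Re w - Im z * Im w.
Proof. by case: z w => [? ?] []. Qed.
Lemma ImM z w : Im (z * w) = Re z * Im w + Im z * Re w.
Proof. by case: z w => [? ?] []. Qed.
Lemma Re_conj z : Re z^* = Re z. Proof. by case: z. Qed.
Lemma Im_conj z : Im z^* = - Im z. Proof. by case: z. Qed.

Lemma normc_sqr z : Normc.normc z ^+ 2 = Re z ^+ 2 + Im z ^+ 2.
Proof. by case: z => a b; rewrite /= sqr_sqrtr// addr_ge0// sqr_ge0. Qed.

Lemma normc_ge0 z : 0 <= Normc.normc z.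
Proof. by case: z => a b; exact: sqrtr_ge0. Qed.

Lemma normr_Re_le z : `|Re z| <= Normc.normc z.
Proof. by case: z => a b; rewrite -sqrtr_sqr /= ler_wsqrtr// lerDl sqr_ge0. Qed.

Lemma normr_Im_le z : `|Im z| <= Normc.normc z.
Proof. by case: z => a b; rewrite -sqrtr_sqr /= ler_wsqrtr// lerDr sqr_ge0. Qed.

End complex_parts.

(** * Real square-integrable functions *)

Section square_integrable.
Context d (T : measurableType d) (R : realType).
Context (mu : {measure set T -> \bar R}).
Context (D : set T) (mD : measurable D).
Implicit Types p q : T -> R.

Definition square_integrable p :=
  measurable_fun D p /\ mu.-integrable D (fun x => (p x ^+ 2)%:E).

(** [|p q| <= p ^ 2 + q ^ 2] pointwise. *)
Lemma square_integrableM {p q} : square_integrable p -> square_integrable q ->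
  mu.-integrable D (fun x => (p x * q x)%:E).
Proof.
move=> [mp ip] [mq iq].
apply: (le_integrable mD _ _ (integrableD mD ip iq)).
  by apply/measurable_EFinP; exact: measurable_funM.
move=> x _ /=; rewrite lee_fin ler_norml ger0_norm; last nra.
by apply/andP; split; nra.
Qed.

Lemma square_integrableD {p q} : square_integrable p -> square_integrable q ->
  square_integrable (fun x => p x + q x).
Proof.
move=> sp sq; have [[mp ip] [mq iq]] := (sp, sq).
split; first exact: measurable_funD.
have := integrableD mD (integrableD mD ip iq)
  (integrableZl mD 2 (square_integrableM sp sq)).
apply: eq_integrable => // x _ /=; rewrite -EFinM -!EFinD; congr (_%:E); ring.
Qed.

Lemma square_integrableZ r {p} : square_integrable p ->
  square_integrable (fun x => r * p x).
Proof.
move=> [mp ip]; split; first exact: measurable_funM.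
have := integrableZl mD (r ^+ 2) ip.
by apply: eq_integrable => // x _ /=; rewrite -EFinM exprMn.
Qed.

End square_integrable.

(** * The semi-inner product of L^2 *)

Section L2_semi_inner_product.
Context {R : realType} {n : nat} {Omega : set 'rV[R]_n}.
Hypothesis mOmega : measurable Omega.
Local Notation mu := (lebesgue_rV n).
Local Notation fn := ('rV[R]_n -> R[i]).
Local Notation L2 := (in_L2 Omega).
Local Notation "<< f , g >>" := (L2_inner Omega f g).
Local Notation sqi := (square_integrable mu Omega).
Implicit Types f g h : fn.

(** Reduces integrability questions about complex functions to real ones. *)
Lemma in_L2P f : L2 f <-> sqi (fun x => Re (f x)) /\ sqi (fun x => Im (f x)).
Proof.
split=> [[mR mI fin]|[[mR iR] [mI iI]]].
  have i2 : mu.-integrable Omega (fun x => (Normc.normc (f x) ^+ 2)%:E).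
    apply/integrableP; split.
      apply/measurable_EFinP; under eq_fun do rewrite normc_sqr.
      by apply: measurable_funD; exact: measurable_funX.
    by under eq_integral do rewrite gee0_abs ?lee_fin ?sqr_ge0//.
  split; split=> //; apply: (le_integrable mOmega _ _ i2);
    (try by apply/measurable_EFinP; exact: measurable_funX) => x _ /=;
    by rewrite lee_fin normc_sqr !ger0_norm; nra.
split=> //.
have /integrableP[_] := integrableD mOmega iR iI.
congr (_ < _)%E; apply: eq_integral => x _ /=.
by rewrite normc_sqr ger0_norm// addr_ge0// sqr_ge0.
Qed.

Lemma in_L2_linear (c : R[i]) {f g} : L2 f -> L2 g -> L2 (c *: f + g).
Proof.
move=> /in_L2P[fR fI] /in_L2P[gR gI]; apply/in_L2P; split.
  under eq_fun do rewrite ReD ReM -mulNr.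
  by do 2?apply: square_integrableD => //; exact: square_integrableZ.
under eq_fun do rewrite ImD ImM.
by do 2?apply: square_integrableD => //; exact: square_integrableZ.
Qed.

Lemma in_L2_0 : L2 (0 : fn).
Proof.
suff s0 : sqi (fun=> 0) by exact/in_L2P.
split=> //; under eq_fun do rewrite expr0n; exact: integrable0.
Qed.

Lemma in_L2Z (c : R[i]) {f} : L2 f -> L2 (c *: f).
Proof.
by move=> Lf; rewrite -[_ *: _]addr0; exact: in_L2_linear Lf in_L2_0.
Qed.

Lemma in_L2D {f g} : L2 f -> L2 g -> L2 (f + g).
Proof. by move=> Lf Lg; rewrite -[f]scale1r; exact: in_L2_linear. Qed.

Lemma in_L2B {f g} : L2 f -> L2 g -> L2 (f - g).
Proof. by move=> Lf Lg; rewrite -scaleN1r addrC; exact: in_L2_linear. Qed.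

Lemma in_L2_sum (J : Type) (s : seq J) (w : J -> fn) :
  (forall j, L2 (w j)) -> L2 (\sum_(j <- s) w j).
Proof.
move=> Lw; elim/big_ind : _ => //; first exact: in_L2_0.
by move=> f g; exact: in_L2D.
Qed.

Lemma integrable_Re_inner {f g} : L2 f -> L2 g ->
  mu.-integrable Omega (fun x => (Re (f x * (g x)^*))%:E).
Proof.
move=> /in_L2P[fR fI] /in_L2P[gR gI].
apply: eq_integrable (integrableD mOmega (square_integrableM mOmega fR gR)
  (square_integrableM mOmega fI gI)) => // x _ /=.
by rewrite -EFinD ReM Re_conj Im_conj mulrN opprK.
Qed.

Lemma integrable_Im_inner {f g} : L2 f -> L2 g ->
  mu.-integrable Omega (fun x => (Im (f x * (g x)^*))%:E).
Proof.
move=> /in_L2P[fR fI] /in_L2P[gR gI].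
apply: eq_integrable (integrableB mOmega (square_integrableM mOmega fI gR)
  (square_integrableM mOmega fR gI)) => // x _ /=.
by rewrite -EFinB ImM Re_conj Im_conj mulrN addrC.
Qed.

Lemma L2_inner_linear (c : R[i]) {f g h} : L2 f -> L2 g -> L2 h ->
  << c *: f + g, h >> = c * << f, h >> + << g, h >>.
Proof.
move=> Lf Lg Lh.
have [Rf If] := (integrable_Re_inner Lf Lh, integrable_Im_inner Lf Lh).
have [Rg Ig] := (integrable_Re_inner Lg Lh, integrable_Im_inner Lg Lh).
have Z r p := @integrableZl _ _ _ mu _ mOmega r (EFin \o p).
case: c => a b; rewrite /L2_inner /cintegral.
apply/eqP; rewrite eq_complex; apply/andP; split; apply/eqP.
  rewrite ReD ReM /= -!RintegralZl// -RintegralB//; [|exact: Z..].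
  rewrite -RintegralD//; last exact: (integrableB mOmega (Z a _ Rf) (Z b _ If)).
  by apply: eq_Rintegral => x _; rewrite mulrDl -mulrA ReD ReM.
rewrite ImD ImM /= -!RintegralZl// -RintegralD//; [|exact: Z..].
rewrite -RintegralD//; last exact: (integrableD mOmega (Z a _ If) (Z b _ Rf)).
by apply: eq_Rintegral => x _; rewrite mulrDl -mulrA ImD ImM.
Qed.

Lemma L2_innerD {f g h} : L2 f -> L2 g -> L2 h ->
  << f + g, h >> = << f, h >> + << g, h >>.
Proof.
by move=> Lf Lg Lh; rewrite -[f]scale1r L2_inner_linear// scale1r mul1r.
Qed.

Lemma L2_innerB {f g h} : L2 f -> L2 g -> L2 h ->
  << f - g, h >> = << f, h >> - << g, h >>.
Proof.
move=> Lf Lg Lh; rewrite addrC -[X in << X + _, _ >>]scaleN1r.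
by rewrite L2_inner_linear// mulN1r addrC.
Qed.

Lemma L2_inner_conj {f g} : L2 f -> L2 g -> << f, g >>^* = << g, f >>.
Proof.
move=> Lf Lg; rewrite /L2_inner /cintegral conjCE /=; congr (_ +i* _).
  by apply: eq_Rintegral => x _; rewrite !ReM !Re_conj !Im_conj; ring.
rewrite -mulN1r -RintegralZl//; last exact: integrable_Im_inner.
by apply: eq_Rintegral => x _; rewrite !ImM !Re_conj !Im_conj; ring.
Qed.

Lemma L2_norm_ge0 f : 0 <= L2_norm Omega f. Proof. exact: sqrtr_ge0. Qed.

Lemma L2_inner_self f : << f, f >> = (L2_norm Omega f ^+ 2)%:C.
Proof.
rewrite sqr_sqrtr; last by apply: Rintegral_ge0 => x _; exact: sqr_ge0.
rewrite /L2_inner /cintegral /real_complex_def; congr (_ +i* _).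
  by apply: eq_Rintegral => x _; rewrite ReM Re_conj Im_conj normc_sqr; ring.
rewrite -[RHS](mul0r (fine (mu Omega))) -Rintegral_cst//.
by apply: eq_Rintegral => x _; rewrite ImM Re_conj Im_conj; ring.
Qed.

(** Lets operators whose identities hold only up to null sets act on
  norm-convergent expansions. *)
Lemma L2_norm_eq_ae {f g} : L2 f -> L2 g -> L2_eq Omega f g ->
  L2_norm Omega f = L2_norm Omega g.
Proof.
move=> [fR fI _] [gR gI _] fg; congr (Num.sqrt (fine _)).
apply: ae_eq_integral => //.
- apply/measurable_EFinP; under eq_fun do rewrite normc_sqr.
  by apply: measurable_funD; exact: measurable_funX.
- apply/measurable_EFinP; under eq_fun do rewrite normc_sqr.
  by apply: measurable_funD; exact: measurable_funX.
by apply: filterS fg => x fgx Dx; rewrite fgx.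
Qed.

(** The discriminant argument: [|f - t (f, g) g|^2 >= 0] for all real [t].  As
  the norm may vanish on a nonzero [g], the case [|g| = 0] is not trivial and
  is settled by a large [t]. *)
Lemma Cauchy_Schwarz {f g} : L2 f -> L2 g ->
  Normc.normc << f, g >> <= L2_norm Omega f * L2_norm Omega g.
Proof.
move=> Lf Lg; set p := << f, g >>.
set X := L2_norm Omega f; set N := L2_norm Omega g.
have [X0 N0] : 0 <= X /\ 0 <= N by split; exact: L2_norm_ge0.
rewrite -(@ler_pXn2r _ 2)// ?nnegrE ?normc_ge0 ?mulr_ge0//.
have quad (t : R) : 0 <= X ^+ 2 - 2 * t * Normc.normc p ^+ 2
    + t ^+ 2 * Normc.normc p ^+ 2 * N ^+ 2.
  pose h := (- (t%:C * p)) *: g + f; have Lh : L2 h by exact: in_L2_linear.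
  suff -> : X ^+ 2 - 2 * t * Normc.normc p ^+ 2
      + t ^+ 2 * Normc.normc p ^+ 2 * N ^+ 2 = L2_norm Omega h ^+ 2.
    exact: sqr_ge0.
  have := L2_inner_self h; rewrite {1}/h L2_inner_linear//.
  rewrite -(L2_inner_conj Lh Lg) -(L2_inner_conj Lh Lf) /h !L2_inner_linear//.
  rewrite !L2_inner_self -(L2_inner_conj Lf Lg) -/p -/X -/N !conjCE.
  rewrite normc_sqr; case: (p) => a b /=.
  move=> /(congr1 (@complex.Re _)); rewrite !(ReD, ReM, ImM, ImD)/= => <-; ring.
(* If N is nonzero, the quadratic in t is minimal at t = 1 / N ^ 2. *)
rewrite exprMn; move: (quad (N ^+ 2)^-1).
have [N2|N2] := eqVneq (N ^+ 2) 0; last first.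
  have N2p : 0 < N ^+ 2 by rewrite lt0r N2 sqr_ge0.
  rewrite [X in 0 <= X -> _](_ : _ = X ^+ 2 - Normc.normc p ^+ 2 / N ^+ 2).
    by rewrite subr_ge0 ler_pdivrMr.
  by move: (N ^+ 2) N2 {N2p} => M M0; field.
move=> _; move: quad; rewrite N2 mulr0 leNgt => quad; apply/negP => p0.
(* A t for which the remaining affine function takes the value -1. *)
have := quad ((X ^+ 2 + 1) / (2 * Normc.normc p ^+ 2)).
rewrite mulr0 addr0 [X in _ <= X](_ : _ = -1) ?ler0N1//.
by move: (Normc.normc p ^+ 2) p0 => M M0; field; rewrite gt_eqF.
Qed.

(** Continuity of the pairing, by parts: the sums of complex series are defined
  from their real and imaginary parts. *)
Lemma inner_cvg {T : Type} {F : set_system T} {FF : Filter F}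
    {s : T -> fn} {h g} :
  (forall t, L2 (s t)) -> L2 h -> L2 g ->
  L2_norm Omega (h - s t) @[t --> F] --> (0 : R) ->
  (Re << s t, g >> @[t --> F] --> Re << h, g >>) /\
  (Im << s t, g >> @[t --> F] --> Im << h, g >>).
Proof.
move=> Ls Lh Lg hs.
have bound t : Normc.normc (<< h, g >> - << s t, g >>) <=
    L2_norm Omega (h - s t) * L2_norm Omega g.
  by rewrite -L2_innerB//; apply: Cauchy_Schwarz => //; exact: in_L2B.
have lim0 : L2_norm Omega (h - s t) * L2_norm Omega g @[t --> F] --> (0 : R).
  by rewrite -[X in _ --> X](mul0r (L2_norm Omega g)); apply: cvgMl.
have part (r : T -> R) (l : R) :
    (forall t, `|l - r t| <= Normc.normc (<< h, g >> - << s t, g >>)) ->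
    r t @[t --> F] --> l.
  move=> rl; apply/cvgrPdist_le => /= e e0.
  apply: filterS (cvgr_le _ lim0 e e0) => t.
  exact: le_trans (le_trans (rl t) (bound t)).
by split; apply: part => t; [rewrite -ReB normr_Re_le|rewrite -ImB normr_Im_le].
Qed.

Lemma Pythagoras_le {f g} : L2 f -> L2 g -> << g, f >> = 0 ->
  L2_norm Omega f <= L2_norm Omega (g + f).
Proof.
move=> Lf Lg gf; rewrite -(@ler_pXn2r _ 2)// ?nnegrE ?L2_norm_ge0//.
have Lgf := in_L2D Lg Lf.
have := L2_inner_self (g + f); rewrite L2_innerD// -(L2_inner_conj Lgf)//.
rewrite -[in X in _ + X](L2_inner_conj Lgf)// !L2_innerD// gf.
rewrite -(L2_inner_conj Lg Lf) gf.
rewrite !L2_inner_self !conjCE /= => /(congr1 (@complex.Re _)).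
by rewrite !ReD /= => <-; rewrite !(addr0, add0r) lerDr sqr_ge0.
Qed.

(** * Unconditional expansions *)

Section expansions.
Context {I : choiceType}.
Implicit Types (u v w e : I -> fn) (a b c : I -> R[i]) (S : {fset I}).

Lemma partial_sumE {V : zmodType} (x : I -> V) S :
  partial_sum x S = \sum_(xi <- S) x xi.
Proof. by rewrite /partial_sum big_seq_fsetE. Qed.

Lemma fin_combE a w S : fin_comb a w S = \sum_(xi <- S) a xi *: w xi.
Proof. by apply/funext => x; rewrite /fin_comb partial_sumE fct_sumE. Qed.

Lemma in_L2_fin_comb a {w} S : (forall xi, L2 (w xi)) -> L2 (fin_comb a w S).
Proof.
by move=> Lw; rewrite fin_combE; apply: in_L2_sum => xi; exact: in_L2Z.
Qed.

Lemma inner_fin_comb a {w} S {g} : (forall xi, L2 (w xi)) -> L2 g ->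
  << fin_comb a w S, g >> = \sum_(xi <- S) a xi * << w xi, g >>.
Proof.
move=> Lw Lg; rewrite fin_combE; elim: (enum_fset S) => [|xi s ih].
  have := L2_inner_linear (-1) in_L2_0 in_L2_0 Lg.
  by rewrite !big_nil scaleN1r addNr mulN1r addNr.
rewrite !big_cons L2_inner_linear ?ih//.
by apply: in_L2_sum => j; exact: in_L2Z.
Qed.

(** A norm-convergent expansion can be paired termwise.  In particular the
  pairings of the sum are determined by the coefficients. *)
Lemma expands_inner {w a h g} :
  (forall xi, L2 (w xi)) -> expands Omega w a h -> L2 g ->
  csummable (fun xi => a xi * << w xi, g >>) /\
  csum (fun xi => a xi * << w xi, g >>) = << h, g >>.
Proof.
move=> Lw [Lh ah] Lg.
have Lfin S := in_L2_fin_comb a S Lw.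
have [cR cI] := inner_cvg Lfin Lh Lg ah.
have ReE : (fun S => Re << fin_comb a w S, g >>) =
    partial_sum (fun xi => Re (a xi * << w xi, g >>)).
  apply/funext => S; rewrite partial_sumE inner_fin_comb//.
  by elim/big_ind2 : _ => // ? ? ? ? <- <-; rewrite ReD.
have ImE : (fun S => Im << fin_comb a w S, g >>) =
    partial_sum (fun xi => Im (a xi * << w xi, g >>)).
  apply/funext => S; rewrite partial_sumE inner_fin_comb//.
  by elim/big_ind2 : _ => // ? ? ? ? <- <-; rewrite ImD.
rewrite {}ReE in cR; rewrite {}ImE in cI.
split; first by split; [exact: cvgP cR|exact: cvgP cI].
by rewrite /csum /sum (cvg_lim _ cR)// (cvg_lim _ cI)//; case: << h, g >>.
Qed.

Lemma csum_delta a (eta : I) : csum (fun xi => a xi * (xi == eta)%:R) = a eta.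
Proof.
have near_eta (x : I -> R) : (forall xi, xi != eta -> x xi = 0) ->
    summability.sum x = x eta.
  move=> x0; apply: lim_near_cst => //.
  exists [fset eta]%fset => // S; rewrite /= fsub1set => etaS.
  rewrite partial_sumE (big_fsetD1 eta)//= big_seq big1 ?addr0// => xi.
  by rewrite !inE => /andP[/x0].
rewrite /csum !near_eta ?eqxx ?mulr1; first by case: (a eta).
- by move=> xi /negPf ->; rewrite mulr0.
- by move=> xi /negPf ->; rewrite mulr0.
Qed.

(** If [S] is contained in [T], then [h] minus its projection on the span of [T]
  is orthogonal to that span, hence no longer than [h] minus any combination
  over [S]; density provides a combination that is close to [h]. *)
Lemma orthonormal_expands {e h} : orthonormal_basis Omega e -> L2 h ->
  expands Omega e (fourier Omega e h) h.
Proof.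
move=> [Le ortho dense] Lh; split=> //; set c := fourier _ _ _.
have Lc S := in_L2_fin_comb c S Le.
have best (S T : {fset I}) b : (S `<=` T)%fset ->
    L2_norm Omega (h - fin_comb c e T) <= L2_norm Omega (h - fin_comb b e S).
  move=> ST; have Lb := in_L2_fin_comb b S Le.
  have LhT := in_L2B Lh (Lc T).
  rewrite [X in _ <= L2_norm _ X](_ : _ =
    (fin_comb c e T - fin_comb b e S) + (h - fin_comb c e T)); last first.
    by rewrite [RHS]addrC subrKA.
  have orth xi : xi \in T -> << e xi, h - fin_comb c e T >> = 0.
    move=> xiT; rewrite -(L2_inner_conj LhT (Le xi)).
    rewrite L2_innerB// inner_fin_comb//.
    rewrite (big_fsetD1 xi)//= ortho eqxx mulr1 big_seq big1.
      by rewrite addr0 subrr conjC0.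
    by move=> eta; rewrite !inE ortho => /andP[/negPf -> _]; rewrite mulr0.
  have orth_comb b' (S' : {fset I}) : (S' `<=` T)%fset ->
      << fin_comb b' e S', h - fin_comb c e T >> = 0.
    move=> /fsubsetP S'T; rewrite inner_fin_comb// big_seq big1// => xi.
    by move=> /S'T xiT; rewrite orth ?mulr0.
  apply: Pythagoras_le => //; first exact: in_L2B.
  by rewrite L2_innerB// !orth_comb// subrr.
apply/cvgrPdist_lt => /= eps eps0; have [S [b Sb]] := dense _ Lh _ eps0.
exists S => // T /= ST; rewrite sub0r normrN ger0_norm ?L2_norm_ge0//.
exact: le_lt_trans (best S T b ST) Sb.
Qed.

(** [U] is linear only up to null sets, one for each use of linearity; a finite
  combination involves finitely many of them. *)
Lemma bounded_linear_fin_comb {U : fn -> fn} {w e} c S :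
  (forall xi, L2 (e xi)) -> bounded_linear Omega U ->
  (forall xi, L2_eq Omega (w xi) (U (e xi))) ->
  L2_eq Omega (U (fin_comb c e S)) (fin_comb c w S).
Proof.
move=> Le [_ linU _] wU; rewrite !fin_combE.
elim: (enum_fset S) => [|xi s ih].
  (* The value at 0 comes from linearity with coefficient -1. *)
  rewrite !big_nil; have := linU (-1) _ _ in_L2_0 in_L2_0.
  rewrite (_ : (fun x => -1 * 0 + 0) = 0); last first.
    by apply/funext => x; rewrite mulr0 addr0.
  by apply: filterS => x /[apply] ->; rewrite mulN1r addNr.
rewrite !big_cons.
have Ls : L2 (\sum_(j <- s) c j *: e j) by apply: in_L2_sum => j; exact: in_L2Z.
move: (linU (c xi) _ _ (Le xi) Ls) (wU xi) ih.
apply: filterS3 => x lin wx ih Dx.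
by rewrite [LHS](lin Dx) (ih Dx) -(wx Dx).
Qed.

(** Up to a null set, the error of the new expansion is the image by [U] of the
  error of the old one. *)
Lemma expands_bounded_linear {U : fn -> fn} {w e} c {h} :
  (forall xi, L2 (e xi)) -> (forall xi, L2 (w xi)) -> bounded_linear Omega U ->
  (forall xi, L2_eq Omega (w xi) (U (e xi))) ->
  expands Omega e c h -> expands Omega w c (U h).
Proof.
move=> Le Lw bU wU [Lh eh]; have [LU linU [M UM]] := bU.
split; first exact: LU.
have Lc S := in_L2_fin_comb c S Le.
have normE S : L2_norm Omega (U h - fin_comb c w S) =
    L2_norm Omega (U (h - fin_comb c e S)).
  apply: L2_norm_eq_ae.
  - by apply: in_L2B; [exact: LU|exact: in_L2_fin_comb].
  - by apply: LU; exact: in_L2B.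
  have := linU (-1) _ _ (Lc S) Lh.
  rewrite (_ : (fun x => -1 * fin_comb c e S x + h x) =
      h - fin_comb c e S); last first.
    by apply/funext => x; rewrite mulN1r addrC.
  move: (bounded_linear_fin_comb c S Le bU wU).
  apply: filterS2 => x wx lin Dx.
  by rewrite (lin Dx) (wx Dx) mulN1r addrC.
apply: (@squeeze_cvgr _ _ _ _ (fun=> 0)
  (fun S => M * L2_norm Omega (h - fin_comb c e S))).
- apply: nearW => S; rewrite L2_norm_ge0 /= normE; apply: UM; exact: in_L2B.
- exact: cvg_cst.
- by rewrite -(mulr0 M); exact: cvgMr.
Qed.

Lemma expands_ae {w a h g} : (forall xi, L2 (w xi)) -> L2 g ->
  L2_eq Omega h g -> expands Omega w a h -> expands Omega w a g.
Proof.
move=> Lw Lg hg [Lh ah]; split=> //.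
rewrite (_ : (fun S => L2_norm Omega (g \- fin_comb a w S)) =
  (fun S => L2_norm Omega (h \- fin_comb a w S)))//.
apply/funext => S; have Lc := in_L2_fin_comb a S Lw.
apply: L2_norm_eq_ae; [exact: in_L2B Lg Lc|exact: in_L2B Lh Lc|].
by apply: filterS hg => x hx Dx; rewrite /= (hx Dx).
Qed.

Lemma riesz_in_L2 {w} : riesz_basis Omega w -> forall xi, L2 (w xi).
Proof. by move=> [e [U [V [_ _ _ _ wU]]]] xi; case: (wU xi). Qed.

(** The orthonormal expansion of [V h], transported by [U], is an expansion of
  [h] along [w]; biorthogonality identifies its coefficients. *)
Lemma riesz_expands {w v h} : riesz_basis Omega w -> (forall xi, L2 (v xi)) ->
  (forall xi eta, << w xi, v eta >> = (xi == eta)%:R) ->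
  L2 h -> expands Omega w (fourier Omega v h) h.
Proof.
move=> rw Lv biortho Lh; have Lw := riesz_in_L2 rw.
have [e [U [V [ortho [bU bV] UV _ wU]]]] := rw.
have Le := let: And3 Le _ _ := ortho in Le.
have LVh : L2 (V h) by case: bV => LV _ _; exact: LV.
pose c := fourier Omega e (V h).
have ch : expands Omega w c h.
  apply: (expands_ae Lw Lh (UV h Lh)).
  apply: (expands_bounded_linear Le Lw bU) => [xi|]; first by have [] := wU xi.
  exact: orthonormal_expands.
suff -> : fourier Omega v h = c by [].
apply/funext => eta; have [_] := expands_inner Lw ch (Lv eta).
by under eq_fun do rewrite biortho; rewrite csum_delta.
Qed.

(** The inverse transform picks an arbitrary representative of the sum, which
  has the same pairings with [w] as [g]. *)
Lemma l2_inner_expands a {w b g} : (forall xi, L2 (w xi)) ->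
  expands Omega w b g ->
  l2_inner Omega w a b = csum (fun xi => a xi * (fourier Omega w g xi)^*).
Proof.
move=> Lw bg; rewrite /l2_inner.
suff -> : fourier Omega w (inv_fourier Omega w b) = fourier Omega w g by [].
have bg' : expands Omega w b (inv_fourier Omega w b).
  by rewrite /inv_fourier; case: xgetP => [//|/(_ g)].
apply/funext => eta; rewrite /fourier.
have [_ <-] := expands_inner Lw bg (Lw eta).
by have [_ <-] := expands_inner Lw bg' (Lw eta).
Qed.

(** Pairs the expansion of [f] with [g]; the expansion of [g] serves to evaluate
  the inner product of sequences. *)
Lemma riesz_Parseval {u v f g} :
  riesz_basis Omega u -> (forall xi, L2 (v xi)) ->
  (forall xi eta, << u xi, v eta >> = (xi == eta)%:R) ->
  L2 f -> L2 g ->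
  let c := fun xi => fourier Omega v f xi * (fourier Omega u g xi)^* in
  [/\ csummable c, csum c = << f, g >> &
      l2_inner Omega u (fourier Omega v f) (fourier Omega v g) = csum c].
Proof.
move=> ru Lv biortho Lf Lg c.
have Lu := riesz_in_L2 ru.
have cE : c = fun xi => fourier Omega v f xi * << u xi, g >>.
  by apply/funext => xi; rewrite /c /fourier (L2_inner_conj Lg (Lu xi)).
have [sc cf] := expands_inner Lu (riesz_expands ru Lv biortho Lf) Lg.
split; [by rewrite cE|by rewrite cE|].
exact: (l2_inner_expands _ Lu (riesz_expands ru Lv biortho Lg)).
Qed.

End expansions.
End L2_semi_inner_product.

(** * The Plancherel and Parseval formulas *)

Theorem proposition6p1 (R : realType) (n : nat) (Omega : set 'rV[R]_n)
    (m : nat) (a : {ffun 'I_n -> 'I_m.+1} -> 'rV[R]_n -> R[i])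
    (BC : set ('rV[R]_n -> R[i])) (K : nat) (I : set 'rV[int]_K)
    (lam : I -> R[i]) (u v : I -> 'rV[R]_n -> R[i])
    (n_gt0 : (0 < n)%N)
    (setting : nonharmonic_setting Omega a BC lam u v) :
  let FL := fourier Omega v in
  let FLs := fourier Omega u in
  let in_l2L := in_l2 Omega u in
  let in_l2Ls := in_l2 Omega v in
  let innerL := l2_inner Omega u in
  let innerLs := l2_inner Omega v in
  let normL := l2_norm Omega u in
  let normLs := l2_norm Omega v in
  (forall f g : 'rV[R]_n -> R[i], in_L2 Omega f -> in_L2 Omega g ->
    [/\ in_l2L (FL f), in_l2L (FL g), in_l2Ls (FLs f) & in_l2Ls (FLs g)] /\
    [/\ csummable (fun xi => FL f xi * (FLs g xi)^*),
        innerL (FL f) (FL g) = csum (fun xi => FL f xi * (FLs g xi)^*),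
        csummable (fun xi => FLs f xi * (FL g xi)^*) &
        innerLs (FLs f) (FLs g) = csum (fun xi => FLs f xi * (FL g xi)^*)] /\
    (innerL (FL f) (FL g))^* = innerLs (FLs g) (FLs f) /\
    L2_inner Omega f g = innerL (FL f) (FL g) /\
    L2_inner Omega f g = csum (fun xi => FL f xi * (FLs g xi)^*)) /\
  (forall f : 'rV[R]_n -> R[i], in_L2 Omega f ->
    [/\ in_l2L (FL f), in_l2Ls (FLs f),
        (L2_norm Omega f)%:C = normL (FL f) &
        normL (FL f) = normLs (FLs f)]).
Proof.
move=> FL FLs in_l2L in_l2Ls innerL innerLs normL normLs.
have mOmega : measurable Omega := open_measurable_rV (ns_open setting).
have [ru rv] := (ns_riesz setting, ns_riesz_adj setting).
have Lu := riesz_in_L2 ru.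
have Lv := riesz_in_L2 rv.
have uv := ns_biorthogonal setting.
have vu xi eta : L2_inner Omega (v xi) (u eta) = (xi == eta)%:R.
  by rewrite -(L2_inner_conj mOmega (Lu eta) (Lv xi)) uv conjC_nat eq_sym.
have Lmem f : in_L2 Omega f -> in_l2L (FL f).
  by exists f; exact: (riesz_expands mOmega ru Lv uv).
have Lsmem f : in_L2 Omega f -> in_l2Ls (FLs f).
  by exists f; exact: (riesz_expands mOmega rv Lu vu).
have innerLE f g : in_L2 Omega f -> in_L2 Omega g ->
    innerL (FL f) (FL g) = L2_inner Omega f g.
  by move=> Lf Lg; have [_ <-] := riesz_Parseval mOmega ru Lv uv Lf Lg.
have innerLsE f g : in_L2 Omega f -> in_L2 Omega g ->
    innerLs (FLs f) (FLs g) = L2_inner Omega f g.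
  by move=> Lf Lg; have [_ <-] := riesz_Parseval mOmega rv Lu vu Lf Lg.
split=> [f g Lf Lg|f Lf].
  have [sL cL iL] := riesz_Parseval mOmega ru Lv uv Lf Lg.
  have [sLs _ iLs] := riesz_Parseval mOmega rv Lu vu Lf Lg.
  split; first by split; [exact: Lmem|exact: Lmem|exact: Lsmem|exact: Lsmem].
  split; first by split; [exact: sL|exact: iL|exact: sLs|exact: iLs].
  split; last by split; [exact/esym/innerLE|exact: esym cL].
  by rewrite (innerLE _ _ Lf Lg) (innerLsE _ _ Lg Lf); exact: L2_inner_conj.
have normLE : normL (FL f) = (L2_norm Omega f)%:C.
  rewrite (_ : normL _ = sqrtC (innerL (FL f) (FL f)))//.
  rewrite (innerLE _ _ Lf Lf) (L2_inner_self mOmega).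
  by rewrite (rmorphXn (real_complex R)) /= sqrCK// lecR L2_norm_ge0.
split; [exact: Lmem|exact: Lsmem|exact: esym normLE|].
apply: (congr1 sqrtC (_ : innerL (FL f) (FL f) = innerLs (FLs f) (FLs f))).
by rewrite (innerLE _ _ Lf Lf) (innerLsE _ _ Lf Lf).
Qed.
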